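(* Let $UB$ be the objective function value of a feasible solution of the discrete $\alpha$-neighbor $p$-center problem. Then when adding $$u_k=0\quad\forall k\in\{2,\dots,K\} \text{ with } d_k>UB$$ to (APC2), no optimal solution of (APC2) is cut off.
   Context: Discrete $\alpha$-neighbor $p$-center problem (d-$\alpha$-$p$CP): given are a finite set of points $N$, a positive integer $p<|N|$, a positive integer $\alpha\le p$, and distances $d_{ij}\ge 0$ for $i,j\in N$. A feasible solution is a set $P\subseteq N$ with $|P|=p$ (open facilities). For $i\in N\setminus P$ let $d_\alpha(P,i)=\min_{A\subseteq P,|A|=\alpha}\max_{j\in A} d_{ij}$, and let $f_\alpha(P)=\max_{i\in N\setminus P} d_\alpha(P,i)$ be the objective function value of $P$. The problem is $\min_{P\subseteq N,|P|=p} f_\alpha(P)$. Let $D=\{d_{ij}: i,j\in N, i\ne j\}=\{d_1,\dots,d_K\}$ with $d_1<d_2<\dots<d_K$, and for $i\in N$ let $D_i=\{d_{ij}: j\in N\setminus\{i\}\}\setminus\{d_1\}$. Formulation (APC2), in variables $u_k$ ($k=2,\dots,K$) and $y_j$ ($j\in N$): minimize $d_1+\sum_{k=2}^K(d_k-d_{k-1})u_k$ subject to - $\sum_{j\in N}y_j=p$; - $u_{k-1}\ge u_k$ for all $k\in\{3,\dots,K\}$; - $\alpha u_k+\sum_{j\in N\setminus\{i\}: d_{ij}<d_k} y_j\ge \alpha(1-y_i)$ for all $i\in N$ and all $d_k\in D_i$; - $u_k\in\{0,1\}$ for all $k\in\{2,\dots,K\}$; $y_j\in\{0,1\}$ for all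 $j\in N$. *)

(* Defs.v *)
From HB Require Import structures.
From mathcomp Require Import all_boot all_order all_algebra.

Set Implicit Arguments.
Unset Strict Implicit.
Unset Printing Implicit Defensive.

Import Order.TTheory GRing.Theory Num.Theory.
Local Open Scope ring_scope.

(* The neutral element of each fold is an entry of the sequence, so these are
   the genuine minimum and maximum of every nonempty sequence (and 0 on the
   empty one). *)
Definition seq_min (R : realFieldType) (s : seq R) : R :=
  \big[Num.min/head 0 s]_(x <- s) x.
Definition seq_max (R : realFieldType) (s : seq R) : R :=
  \big[Num.max/head 0 s]_(x <- s) x.

Section Problem.

Variables (R : realFieldType) (N : finType) (p alpha : nat) (d : N -> N -> R).

Definition feasible (P : {set N}) : Prop := #|P| = p.

Definition d_alpha (P : {set N}) (i : N) : R :=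
  seq_min [seq seq_max [seq d i j | j in A]
          | A : {set N} in [set A : {set N} | (A \subset P) && (#|A| == alpha)]].

Definition f_alpha (P : {set N}) : R :=
  seq_max [seq d_alpha P i | i in ~: P].

(* The increasing list d_1 < ... < d_K of the values d_ij, i != j. *)
Definition dist_values : seq R :=
  sort <=%R (undup [seq d ij.1 ij.2 | ij : N * N in [pred ij | ij.1 != ij.2]]).

Definition K : nat := size dist_values.

(* d_k, numbered from 1; only meaningful for 1 <= k <= K. *)
Definition dval (k : nat) : R := nth 0 dist_values k.-1.

Definition Dset (i : N) : pred R :=
  [pred x | (x \in [seq d i j | j in [pred j | j != i]]) && (x != dval 1)].

(* The variables u_k exist for k = 2, ..., K only: the values of u : nat -> R
   at other indices occur neither in the constraints nor in the objective. *)
Definition APC2_feasible (u : nat -> R) (y : N -> R) : Prop :=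
  [/\ \sum_(j : N) y j = p%:R,
      forall k : nat, (3 <= k <= K)%N -> u k.-1 >= u k,
      forall (i : N) (k : nat), (1 <= k <= K)%N -> dval k \in Dset i ->
        alpha%:R * u k + \sum_(j : N | (j != i) && (d i j < dval k)) y j
          >= alpha%:R * (1 - y i),
      forall k : nat, (2 <= k <= K)%N -> u k = 0 \/ u k = 1
    & forall j : N, y j = 0 \/ y j = 1].

Definition APC2_objective (u : nat -> R) : R :=
  dval 1 + \sum_(2 <= k < K.+1) (dval k - dval k.-1) * u k.

Definition APC2_optimal (u : nat -> R) (y : N -> R) : Prop :=
  APC2_feasible u y /\
  forall (u' : nat -> R) (y' : N -> R),
    APC2_feasible u' y' -> APC2_objective u <= APC2_objective u'.

Definition APC2_UB_feasible (UB : R) (u : nat -> R) (y : N -> R) : Prop :=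
  APC2_feasible u y /\
  forall k : nat, (2 <= k <= K)%N -> dval k > UB -> u k = 0.

End Problem.

(* Main.v *)
Require Import Defs.
From HB Require Import structures.
From mathcomp Require Import all_boot all_order all_algebra.

(** A feasible set [P] of value [UB] yields a solution of the formulation: take
    for [y] the indicator of [P], and let [u k] be the truth value of
    [dval d k <= UB].  If a nonincreasing 0/1 sequence [u] has [u k = 1] for some
    [k] with [dval d k > UB], then it equals 1 up to [k], hence at every index
    whose distance is at most [UB]: it dominates the threshold sequence of
    [UB], and strictly so at [k].  The objective has the positive coefficients
    [dval d k - dval d k.-1], so such a [u] costs strictly more than the
    solution built from [P] and is not optimal
    ([APC2_objective_threshold_lt]).  No value of the objective is computed:
    comparing the two sequences index by index is enough. *)

Set Implicit Arguments.
Unset Strict Implicit.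
Unset Printing Implicit Defensive.

Import Order.TTheory GRing.Theory Num.Theory.
Local Open Scope ring_scope.

Lemma le_seq_max (R : realFieldType) (s : seq R) (x : R) :
  x \in s -> x <= seq_max s.
Proof. by move=> xs; exact: (le_bigmax_seq _ _ xpredT id). Qed.

Lemma seq_min_mem (R : realFieldType) (s : seq R) :
  s != [::] -> seq_min s \in s.
Proof.
case: s => // a s _.
rewrite /seq_min /= big_seq; elim/big_ind: _ => [|x y xs ys|//].
  exact: mem_head.
by rewrite minElt; case: ifP.
Qed.

Section Threshold.

Variables (R : realFieldType) (N : finType) (p alpha : nat) (d : N -> N -> R).

Lemma dist_values_lt_sorted : sorted <%R (dist_values d).
Proof. by rewrite sort_lt_sorted undup_uniq. Qed.

Lemma dval_lt (k l : nat) : (1 <= k <= K d)%N -> (1 <= l <= K d)%N ->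
  (dval d k < dval d l) = (k < l)%N.
Proof.
case: k => // k; case: l => // l /= kK lK.
by rewrite /dval /= (lt_sorted_ltn_nth 0 dist_values_lt_sorted).
Qed.

Lemma d_alpha_le_f_alpha (P : {set N}) (i : N) :
  i \notin P -> d_alpha alpha d P i <= f_alpha alpha d P.
Proof.
by move=> iP; apply: le_seq_max; apply/imageP; exists i; rewrite ?inE.
Qed.

(** The minimum defining [d_alpha] is attained because [P] is large enough to
    have subsets of cardinality [alpha]; otherwise [seq_min] would return its
    default value. *)
Lemma d_alpha_witness (P : {set N}) (i : N) : (alpha <= #|P|)%N ->
  exists A : {set N}, [/\ A \subset P, #|A| = alpha &
    forall j, j \in A -> d i j <= d_alpha alpha d P i].
Proof.
move=> alphaP; rewrite /d_alpha.
set s := image _ _.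
have s0 : s != [::].
  rewrite -size_eq0 size_image -lt0n; apply/card_gt0P.
  have : (0 < #|[set A : {set N} | A \subset P & #|A| == alpha]|)%N.
    by rewrite cards_draws bin_gt0.
  by case/card_gt0P => A; exists A.
have /imageP[A] := seq_min_mem s0.
rewrite inE => /andP[AP /eqP cA] ->; exists A; split=> // j jA.
by apply: le_seq_max; apply/imageP; exists j.
Qed.

(** The largest 0/1 sequence satisfying the cut at level [UB]. *)
Definition threshold (UB : R) (k : nat) : R := (dval d k <= UB)%R%:R.

(** Beyond the level [f_alpha alpha d P], a point [i] outside [P] has [alpha]
    open facilities strictly closer than [dval d k], so the covering constraint
    holds without the help of [u k]. *)
Lemma threshold_feasible (P : {set N}) :
  feasible p P -> (alpha <= p)%N ->
  APC2_feasible p alpha d (threshold (f_alpha alpha d P))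
    (fun j => (j \in P)%:R).
Proof.
move=> cP alpha_le; rewrite /threshold; split.
- by rewrite -natr_sum -cP -sum1_card [in RHS]big_mkcond.
- case=> [//|k] /andP[k3 kK] /=.
  have ltk : dval d k < dval d k.+1.
    by rewrite dval_lt ?kK ?(ltnW kK) ?andbT ?(ltnW (k3 : (1 < k)%N)).
  case: (leP (dval d k.+1)) => [le_k|_]; last exact: ler0n.
  by rewrite (le_trans (ltW ltk) le_k).
- move=> i k kK _; have [iP|iP] := boolP (i \in P).
    rewrite subrr mulr0 addr_ge0 ?mulr_ge0 ?ler0n //.
    by apply: sumr_ge0 => j _; exact: ler0n.
  rewrite subr0 mulr1; case: (leP (dval d k)) => [_|lt_k].
    by rewrite mulr1 lerDl; apply: sumr_ge0 => j _; exact: ler0n.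
  rewrite mulr0 add0r -natr_sum ler_nat.
  have [|A [AP cA dA]] := @d_alpha_witness P i; first by rewrite cP.
  rewrite -[leqLHS]cA -sum1_card big_mkcond [leqRHS]big_mkcond.
  apply: leq_sum => j _; case: ifP => // jA.
  have jP := subsetP AP j jA.
  have -> : j != i by apply: contraNneq iP => <-.
  have -> : d i j < dval d k.
    exact: le_lt_trans (le_trans (dA j jA) (d_alpha_le_f_alpha iP)) lt_k.
  by rewrite jP.
- by move=> k _; case: leP; [right|left].
- by move=> j; case: (j \in P); [right|left].
Qed.

Lemma APC2_feasible_prefix_one (u : nat -> R) (y : N -> R) (k m : nat) :
  APC2_feasible p alpha d u y -> (2 <= m <= k)%N -> (k <= K d)%N ->
  u k = 1 -> u m = 1.
Proof.
move=> [_ umono _ u01 _] /andP[m2 mk] kK uk.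
have : u m >= 1.
  elim: k mk kK uk => [|k IH] mk kK uk; first by case: m m2 mk.
  move: mk; rewrite leq_eqVlt => /orP[/eqP -> //|]; first by rewrite uk.
  rewrite ltnS => mk.
  have k2 := leq_trans m2 mk.
  have uk1 : 1 <= u k by rewrite -uk; apply: (umono k.+1); rewrite ltnS k2.
  have [|uk0|uk1'] := u01 k; first by rewrite k2 ltnW.
    by move: uk1; rewrite uk0 ler10.
  by apply: IH => //; exact: ltnW.
have [|->|->//] := u01 m; first by rewrite m2 (leq_trans mk).
by rewrite ler10.
Qed.

(** Since [u] is 1 up to [k], and [k] lies above every index where the
    threshold sequence is 1, [u] dominates that sequence, strictly at [k]. *)
Lemma APC2_objective_threshold_lt (UB : R) (u : nat -> R) (y : N -> R)
    (k : nat) :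
  APC2_feasible p alpha d u y -> (2 <= k <= K d)%N -> UB < dval d k ->
  u k = 1 -> APC2_objective d (threshold UB) < APC2_objective d u.
Proof.
move=> ufeas /andP[k2 kK] UBk uk; rewrite ltrD2l.
have step m : (2 <= m < (K d).+1)%N -> 0 < dval d m - dval d m.-1.
  move=> /andP[m2]; rewrite ltnS => mK; rewrite subr_gt0.
  case: m m2 mK => [|[|m]] // _ mK.
  by rewrite dval_lt ?ltnSn ?mK ?(ltnW mK).
have dom m : (2 <= m < (K d).+1)%N -> threshold UB m <= u m.
  move=> /andP[m2]; rewrite ltnS => mK; rewrite /threshold.
  case: (leP (dval d m)) => [mUB|_].
    have mk : (m < k)%N.
      rewrite -dval_lt ?mK ?kK ?(ltnW m2) ?(ltnW k2) //.
      exact: le_lt_trans mUB UBk.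
    by rewrite (APC2_feasible_prefix_one ufeas _ kK uk) ?m2 ?(ltnW mk).
  have [_ _ _ u01 _] := ufeas.
  by case: (u01 m) => [|->|->]; rewrite ?m2 ?ler01.
have kr : k \in index_iota 2 (K d).+1 by rewrite mem_index_iota k2 ltnS.
rewrite (bigD1_seq k kr (iota_uniq _ _)) [ltRHS](bigD1_seq k kr (iota_uniq _ _)).
rewrite ltr_leD //.
  by rewrite uk mulr1 /threshold leNgt UBk mulr0 step ?k2.
rewrite big_seq_cond [leRHS]big_seq_cond; apply: ler_sum => m /andP[].
by rewrite mem_index_iota => mK _; rewrite ler_wpM2l ?dom ?ltW ?step.
Qed.

End Threshold.

Theorem theorem10 (R : realFieldType) (N : finType) (p alpha : nat)
    (d : N -> N -> R)
    (p_gt0 : (0 < p)%N) (p_lt : (p < #|N|)%N)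
    (alpha_gt0 : (0 < alpha)%N) (alpha_le : (alpha <= p)%N)
    (d_ge0 : forall i j : N, 0 <= d i j)
    (UB : R)
    (UB_def : exists P : {set N}, feasible p P /\ UB = f_alpha alpha d P) :
  forall (u : nat -> R) (y : N -> R),
    APC2_optimal p alpha d u y -> APC2_UB_feasible p alpha d UB u y.
Proof.
move=> u y [ufeas uopt]; split=> // k kK UBk.
have [_ _ _ u01 _] := ufeas.
have [//|uk] := u01 k kK.
have lt_obj := APC2_objective_threshold_lt ufeas kK UBk uk.
have [P [cP UBE]] := UB_def.
have := uopt _ _ (threshold_feasible d cP alpha_le).
by rewrite -UBE leNgt lt_obj.
Qed.
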